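(* Let $\mu=\sum_{j=1}^N\omega_j\delta_{x_j}$ and $\nu=\sum_{i=1}^M\vartheta_i\delta_{y_i}$ be finitely supported probability measures on $\mathbb{R}$ with $x_1<\dots<x_N$, $y_1<\dots<y_M$, $\mu\leq_c\nu$, $\mu\neq\nu$, and such that $\mu$ has at least two different atoms of positive mass. Then there exists exactly one left-monotone martingale transport plan in $\mathcal{M}_2(\mu,\nu)$.
   Context: Here $N,M\in\mathbb{N}$, $x_j,y_i\in\mathbb{R}$, $\omega_j,\vartheta_i\ge 0$, $\sum_j\omega_j=\sum_i\vartheta_i=1$, and $\delta_x$ is the Dirac measure at $x$. $\mathrm{supp}$ denotes the support of a measure (the set of atoms of positive mass). Convex order: $\mu\leq_c\nu$ means $\int f\,d\mu\le\int f\,d\nu$ for every convex $f:\mathbb{R}\to\mathbb{R}$ for which the integrals exist. $\mathcal{M}_2(\mu,\nu)$ is the set of martingale transport plans, i.e. of probability measures $\mathbb{Q}=\sum_{j=1}^N\sum_{i=1}^M q_{j,i}\delta_{(x_j,y_i)}$ with $q_{j,i}\ge0$, $\sum_{i}q_{j,i}=\omega_j$ for all $j$, $\sum_j q_{j,i}=\vartheta_i$ for all $i$, and $\sum_i q_{j,i}(y_i-x_j)=0$ for all $j$. A martingale transport plan $\mathbb{Q}\in\mathcal{M}_2(\mu,\nu)$ is called left-monotone if there is a set $\Gamma\subseteq\mathrm{supp}(\mu)\times\mathrm{supp}(\nu)$ with $\mathbb{Q}(\Gamma)=1$ such that for all $(x,y^-),(x,y^+),(x',y')\in\Gamma$ with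 $x<x'$ one has $y'\notin(y^-,y^+)$. *)

(* Defs.v *)
From HB Require Import structures.
From mathcomp Require Import all_boot all_order all_algebra.
From mathcomp Require Import all_classical all_reals all_analysis.

Set Implicit Arguments.
Unset Strict Implicit.
Unset Printing Implicit Defensive.

Import Order.TTheory GRing.Theory Num.Theory.

Local Open Scope classical_set_scope.
Local Open Scope ring_scope.

(* [measurableTypeR R] is R with its Borel sigma-algebra; the carrier is
   convertible to R. *)
Notation line R := (measurableTypeR R).

Notation plane R := (line R * line R)%type.

(* sum_i c_i delta_(a_i).  Dirac measures are total functions on all sets in the
   library, so the equalities of measures below are equalities on all sets. *)
Definition atomic (R : realType) (n : nat) (c a : 'I_n -> R) :
    set (line R) -> \bar R :=
  fun A => (\sum_(i < n) (c i)%:E * \d_(a i : line R) A)%E.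

(* For finitely supported measures: the set of atoms of positive mass. *)
Definition supp (R : realType) (mu : probability (line R) R) : set R :=
  [set a | (0 < mu [set a])%E].

(* [R^o] is only R seen as a vector space over itself, as [convex_function]
   requires. *)
Definition convex_order (R : realType) (mu nu : probability (line R) R) : Prop :=
  forall f : R -> R,
    convex_function [set: R^o] f ->
    mu.-integrable [set: line R] (EFin \o f) ->
    nu.-integrable [set: line R] (EFin \o f) ->
    (\int[mu]_z (f z)%:E <= \int[nu]_z (f z)%:E)%E.

Definition martingale_plans (R : realType) (N M : nat)
    (omega x : 'I_N -> R) (theta y : 'I_M -> R) :
    set (probability (plane R) R) :=
  [set Q | exists q : 'I_N -> 'I_M -> R,
    (forall j i, 0 <= q j i) /\
    (forall j, \sum_(i < M) q j i = omega j) /\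
    (forall i, \sum_(j < N) q j i = theta i) /\
    (forall j, \sum_(i < M) q j i * (y i - x j) = 0) /\
    (forall A : set (plane R),
      Q A = \sum_(j < N) \sum_(i < M)
              (q j i)%:E * \d_((x j, y i) : plane R) A)%E].

(* Gamma lies in a product of supports, which is finite for the measures
   considered; its measurability is then automatic. *)
Definition left_monotone (R : realType) (mu nu : probability (line R) R)
    (Q : probability (plane R) R) : Prop :=
  exists Gamma : set (plane R),
    Gamma `<=` supp mu `*` supp nu /\
    Q Gamma = 1%E /\
    forall a b b' a' c : R,
      Gamma (a, b) -> Gamma (a, b') -> Gamma (a', c) -> a < a' ->
      ~ (b < c /\ c < b').

(* Main.v *)
Require Import Defs.
From HB Require Import structures.
From mathcomp Require Import all_boot all_order all_algebra.
From mathcomp Require Import all_classical all_reals all_analysis.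
From mathcomp Require Import measurable_realfun.
From mathcomp Require Import ring lra.

Set Implicit Arguments.
Unset Strict Implicit.
Unset Printing Implicit Defensive.

Import Order.TTheory GRing.Theory Num.Theory.

Local Open Scope classical_set_scope.
Local Open Scope ring_scope.

(** Both halves of the statement are about the matrix of weights [q], and there
the order of the atoms is all that matters: left-monotonicity says that no
later row charges a point strictly between two points charged by an earlier
row.  So each row, compared with what the earlier rows leave of [theta] (the
residual), takes everything strictly between its extreme points: it is a
[contiguous] piece of the residual.

Uniqueness.  A contiguous piece is determined by its mass and its barycentre.
The difference of two such pieces is orthogonal to affine functions, so if it
is not zero its signs alternate at least twice ([alternating_signs]); at the
middle one of three alternating points, one piece has positive mass on both
sides but falls short of the other, which contiguity forbids.  As the mass of
a row is prescribed and its barycentre is prescribed by the martingale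
condition, the rows agree one after the other ([left_curtain_unique]).

Existence.  The quantile bands of mass [m] of [theta] are contiguous, and their
barycentre depends continuously on the position of the band.  The convex order
puts the barycentre wanted for the first row between those of the lowest and
the highest band, so the intermediate value theorem yields a first row ([exists_shadow]).
The convex order is then inherited by the remaining atoms of [omega] and the
residual of [theta] ([residual_potential_le]), and one recurses
([left_curtain_exists]).  The convex order enters only through the total masses
and the potentials [K |-> sum_i w_i |u_i - K|].

The remaining part translates between these matrices and measures: integration
against atomic measures turns the convex order into an inequality of potentials
([convex_order_potential]), and left-monotonicity of a plan into that of its
matrix ([left_monotoneP]). *)

(** * Contiguous pieces of a weight *)

Section Contiguous.
Variables (R : realFieldType) (M : nat) (y : 'I_M -> R).
Hypothesis y_incr : forall i k : 'I_M, (i < k)%N -> y i < y k.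
Implicit Types (d theta eta : 'I_M -> R) (i : 'I_M).

Definition contiguous theta eta :=
  forall i1 i i2, (i1 < i)%N -> (i < i2)%N -> 0 < eta i1 -> 0 < eta i2 ->
    eta i = theta i.

(** If no positive value followed
the first negative one, at [b], then [d] would change sign only at [b], so that
[d i * (y b - y i)] would be nonnegative throughout although its sum is 0. *)
Let pos_neg_pos d (a : 'I_M) :
    \sum_i d i = 0 -> \sum_i d i * y i = 0 ->
    (forall i, (i < a)%N -> d i = 0) -> 0 < d a ->
  exists i1 i2 i3, [/\ (i1 < i2)%N, (i2 < i3)%N, 0 < d i1, d i2 < 0 & 0 < d i3].
Proof.
move=> d0 dy0 a_min da.
have [b0 db0] : exists i, d i < 0.
  apply: contrapT => /forallNP nneg.
  have d_ge0 i : 0 <= d i by rewrite leNgt; apply/negP/nneg.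
  by move: da; rewrite (psumr_eq0P _ d0) ?ltxx.
case: (@arg_minnP _ b0 (fun i => d i < 0) (fun i => i : nat) db0) => b db b_min.
have ab : (a < b)%N.
  rewrite ltnNge leq_eqVlt negb_or; apply/andP; split.
    apply/eqP => /val_inj ba; by move: db; rewrite ba ltNge ltW.
  by apply/negP => /a_min db'; rewrite db' ltxx in db.
have [[c /andP[bc dc]]|] := pselect (exists i, (b < i)%N && (0 < d i)).
  by exists a, b, c.
move=> /forallNP noc.
have centred : \sum_i d i * (y b - y i) = 0.
  under eq_bigr do rewrite mulrBr.
  by rewrite sumrB -mulr_suml d0 dy0 mul0r subr0.
have term_ge0 i : 0 <= d i * (y b - y i).
  have [ib|bi|/val_inj->] := ltngtP i b; last by rewrite subrr mulr0.
  - have di : 0 <= d i by rewrite leNgt; apply/negP => /b_min; rewrite leqNgt ib.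
    by rewrite mulr_ge0// subr_ge0 ltW ?y_incr.
  - have di : d i <= 0 by rewrite leNgt; apply/negP => di; apply: (noc i); rewrite bi.
    by rewrite mulr_le0// subr_le0 ltW ?y_incr.
have : d a * (y b - y a) = 0 by exact: (psumr_eq0P _ centred).
by move=> /eqP; rewrite gt_eqF// mulr_gt0// subr_gt0 y_incr.
Qed.

(** Discrete form of the fact that a function orthogonal to all affine functions
changes sign at least twice. *)
Lemma alternating_signs d i0 :
    \sum_i d i = 0 -> \sum_i d i * y i = 0 -> d i0 != 0 ->
  exists i1 i2 i3, [/\ (i1 < i2)%N, (i2 < i3)%N &
    [/\ 0 < d i1, d i2 < 0 & 0 < d i3] \/ [/\ d i1 < 0, 0 < d i2 & d i3 < 0]].
Proof.
move=> d0 dy0 di0.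
case: (@arg_minnP _ i0 (fun i => d i != 0) (fun i => i : nat) di0) => a da a_min.
have before i : (i < a)%N -> d i = 0.
  by move=> ia; apply/eqP/negPn/negP => /a_min; rewrite leqNgt ia.
move: da; rewrite neq_lt => /orP[da|da]; last first.
  have [i1 [i2 [i3 [*]]]] := pos_neg_pos d0 dy0 before da.
  by exists i1, i2, i3; split=> //; left.
have [||i|| i1 [i2 [i3 []]]] := @pos_neg_pos (fun i => - d i) a.
- by rewrite sumrN d0 oppr0.
- by under eq_bigr do rewrite mulNr; rewrite sumrN dy0 oppr0.
- by move=> /before ->; rewrite oppr0.
- by rewrite oppr_gt0.
rewrite !oppr_gt0 oppr_lt0 => *.
by exists i1, i2, i3; split=> //; right.
Qed.

(** At the middle of three alternating signs of [eta - eta'], the piece that is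
positive at both outer points equals [theta], so it cannot be the smaller one. *)
Lemma contiguous_unique theta eta eta' :
    (forall i, 0 <= eta i <= theta i) -> (forall i, 0 <= eta' i <= theta i) ->
    contiguous theta eta -> contiguous theta eta' ->
    \sum_i eta i = \sum_i eta' i ->
    \sum_i eta i * y i = \sum_i eta' i * y i ->
  eta =1 eta'.
Proof.
move=> bd bd' cont cont' mass mean i; apply/eqP; rewrite -subr_eq0.
apply: contraT => di.
have [||i1 [i2 [i3 [i12 i23 [[p1 n2 p3]|[n1 p2 n3]]]]]] :=
    @alternating_signs (fun i => eta i - eta' i) i _ _ di.
- by rewrite sumrB mass subrr.
- by under eq_bigr do rewrite mulrBl; rewrite sumrB mean subrr.
- move: (bd i1) (bd' i1) (bd i3) (bd' i3) (bd' i2) (cont _ _ _ i12 i23); lra.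
- move: (bd i1) (bd' i1) (bd i3) (bd' i3) (bd i2) (cont' _ _ _ i12 i23); lra.
Qed.

End Contiguous.

(** * Uniqueness of the left-monotone matrix *)

Section Plans.
Variables (R : realFieldType) (N M : nat).
Implicit Types (omega x : 'I_N -> R) (theta y : 'I_M -> R) (q : 'I_N -> 'I_M -> R).

Definition martingale_coupling omega x theta y q :=
  [/\ forall j i, 0 <= q j i,
      forall j, \sum_i q j i = omega j,
      forall i, \sum_j q j i = theta i &
      forall j, \sum_i q j i * (y i - x j) = 0].

(** Left-monotonicity for the support of the plan, read on indices. *)
Definition left_curtain q :=
  forall (j j' : 'I_N) (i1 i i2 : 'I_M),
    (j < j')%N -> (i1 < i)%N -> (i < i2)%N -> 0 < q j i1 -> 0 < q j i2 ->
    q j' i = 0.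

Lemma row_moment omega x theta y q j :
  martingale_coupling omega x theta y q ->
  \sum_i q j i * y i = omega j * x j.
Proof.
move=> [_ row _ mart]; apply/eqP; rewrite -subr_eq0 -(row j) mulr_suml -sumrB.
by rewrite -[X in _ == X](mart j); apply/eqP/eq_bigr => i _; rewrite mulrBr.
Qed.

(** The residual at [i] is [q j i] plus what the later rows put there, and the
latter vanishes strictly between two points charged by row [j]. *)
Lemma row_contiguous omega x theta y q (j : 'I_N) :
    martingale_coupling omega x theta y q -> left_curtain q ->
  let residual i := theta i - \sum_(k < N | (k < j)%N) q k i in
  (forall i, 0 <= q j i <= residual i) /\ contiguous residual (q j).
Proof.
move=> [q_ge0 _ col _] curtain /=.
have split_col i :
    theta i - \sum_(k < N | (k < j)%N) q k i =
    q j i + \sum_(k < N | (j < k)%N) q k i.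
  rewrite -col (bigID (fun k : 'I_N => (k < j)%N))/= [LHS]addrC addKr.
  rewrite (bigD1 j) ?ltnn//=; congr (_ + _); apply: eq_bigl => k.
  by rewrite -leqNgt [RHS]ltn_neqAle andbC eq_sym.
split=> [i|i1 i i2 i12 i23 p1 p3]; rewrite split_col.
  by rewrite q_ge0 lerDl sumr_ge0.
by rewrite big1 ?addr0// => k jk; exact: (curtain j k i1 i i2).
Qed.

Lemma left_curtain_unique omega x theta y q q' :
    (forall i k : 'I_M, (i < k)%N -> y i < y k) ->
    martingale_coupling omega x theta y q -> left_curtain q ->
    martingale_coupling omega x theta y q' -> left_curtain q' ->
  forall j i, q j i = q' j i.
Proof.
move=> y_incr cpl lc cpl' lc' j.
have [n] := ubnP j; elim: n j => // n IHn j; rewrite ltnS => jn.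
have [bd ct] := row_contiguous j cpl lc.
have [bd' ct'] := row_contiguous j cpl' lc'.
have same i : theta i - \sum_(k < N | (k < j)%N) q k i =
              theta i - \sum_(k < N | (k < j)%N) q' k i.
  by congr (_ - _); apply: eq_bigr => k kj; apply: IHn; exact: leq_trans kj jn.
apply: (contiguous_unique y_incr bd) ct _ _ _.
- by move=> i; rewrite same.
- by move=> i1 i i2 *; rewrite same; exact: (ct' i1 i i2).
- by case: cpl cpl' => _ -> _ _ [_ -> _ _].
- by rewrite (row_moment _ cpl) (row_moment _ cpl').
Qed.

End Plans.

(** * A contiguous piece with prescribed mass and barycentre *)

Section Shadow.
Import numFieldNormedType.Exports.
Variables (R : realType) (M : nat) (theta y : 'I_M -> R).
Hypothesis theta_ge0 : forall i, 0 <= theta i.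
Hypothesis y_incr : forall i k : 'I_M, (i < k)%N -> y i < y k.

Let cum (n : nat) : R := \sum_(i < M | (i < n)%N) theta i.

Let cum0 : cum 0 = 0. Proof. by rewrite /cum big_pred0. Qed.

Let cumM : cum M = \sum_i theta i.
Proof. by apply: eq_bigl => i; rewrite ltn_ord. Qed.

Let cumS (i : 'I_M) : cum i.+1 = cum i + theta i.
Proof.
rewrite /cum (bigD1 i) ?ltnSn//= addrC; congr (_ + _); apply: eq_bigl => k.
by rewrite ltnS [RHS]ltn_neqAle andbC.
Qed.

Let le_cum (m n : nat) : (m <= n)%N -> cum m <= cum n.
Proof.
move=> mn; rewrite /cum [leRHS](bigID (fun i : 'I_M => (i < m)%N))/=.
rewrite [X in _ <= X + _](_ : _ = cum m) ?lerDl ?sumr_ge0//.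
apply: eq_bigl => i; case: (ltnP i m) => im; rewrite ?andbF// andbT.
exact: leq_trans im mn.
Qed.

(** The mass that the lowest part of [theta] of total mass [s] has at atom [i],
in a form that telescopes over [i] and is visibly continuous in [s]. *)
Let lower (s : R) (i : 'I_M) : R := Num.min (cum i.+1) s - Num.min (cum i) s.

Let lower_bounds s i : 0 <= lower s i <= theta i.
Proof.
rewrite /lower cumS; move: (theta_ge0 i).
by case: (leP (cum i + theta i) s); case: (leP (cum i) s); lra.
Qed.

Let lower_homo s t i : s <= t -> lower s i <= lower t i.
Proof.
move=> st; rewrite /lower cumS; have ti := theta_ge0 i.
case: (leP (cum i + theta i) s); case: (leP (cum i) s);
case: (leP (cum i + theta i) t); case: (leP (cum i) t) => *; lra.
Qed.

Let lower_mass s : 0 <= s <= \sum_i theta i -> \sum_i lower s i = s.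
Proof.
move=> /andP[s_ge0 s_le].
rewrite -(big_mkord xpredT (fun k => Num.min (cum k.+1) s - Num.min (cum k) s)).
by rewrite (telescope_sumr (fun k => Num.min (cum k) s))// cum0 cumM (min_r s_le)
  (min_l s_ge0) subr0.
Qed.

(** The quantile [b] of [theta] at level [s]: the lowest part of mass [s] contains
all of [theta] below [b] and nothing above. *)
Let lower_barrier s : (0 < M)%N -> 0 <= s <= \sum_i theta i ->
  exists b, forall i, lower s i * (b - y i) = theta i * Num.max (b - y i) 0.
Proof.
move=> M_gt0 /andP[s_ge0 s_le].
have exn : exists n, s <= cum n.+1 by exists M.-1; rewrite prednK// cumM.
case: (ex_minnP exn) => n sn n_min.
have nM : (n < M)%N by rewrite -(prednK M_gt0) ltnS n_min// prednK// cumM.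
have ns : cum n <= s.
  case: n sn n_min nM => [|n] sn n_min nM; first by rewrite cum0.
  by rewrite leNgt; apply/negP => /ltW /n_min; rewrite ltnn.
exists (y (Ordinal nM)) => i; have [ni|ni|ni] := ltngtP i n.
- have yi : y i < y (Ordinal nM) by exact: y_incr.
  rewrite max_l ?subr_ge0 ?ltW// /lower !min_l; last 2 first.
  + exact: le_trans (le_cum (ltnW ni)) ns.
  + exact: le_trans (le_cum ni) ns.
  by rewrite cumS addrC addKr.
- have yi : y (Ordinal nM) < y i by exact: y_incr.
  rewrite max_r ?subr_le0 ?ltW// mulr0 /lower !min_r ?subrr ?mul0r//.
  + exact: le_trans sn (le_cum ni).
  + by apply: le_trans sn (le_cum _); exact: ltnW.
- by rewrite (_ : Ordinal nM = i) ?subrr ?maxxx ?mulr0//; exact: val_inj.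
Qed.

Let lower_continuous i : continuous ((fun s => lower s i) : R -> R).
Proof.
move=> s; apply: cvgB; apply: (@continuous_min R R^o (cst _) id s) => //;
  exact: cvg_cst.
Qed.

Let band_continuous m :
  continuous (fun s : R => \sum_i (lower (s + m) i - lower s i) * y i).
Proof.
move=> s; apply: (@cvg_big R^o 'I_M +%R 0 xpredT add_continuous).
move=> i _; apply: cvgM; last exact: cvg_cst.
apply: cvgB; last exact: lower_continuous.
apply: (@continuous_comp R^o R^o R^o (fun s => s + m) (lower^~ i)).
  by apply: cvgD; [exact: cvg_id|exact: cvg_cst].
exact: lower_continuous.
Qed.

(** The shadow in [theta] of the mass [m] at [a].  The bounds on puts and calls say that [m] times the Dirac mass at [a] is below
[theta] in the convex order for measures of unequal mass.  Evaluated at the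
quantile that bounds the lowest (highest) band, the put (call) inequality says
exactly that the barycentre of that band is at most (at least) [a]. *)
Lemma exists_shadow (m a : R) :
    0 <= m <= \sum_i theta i ->
    (forall K, m * (K - a) <= \sum_i theta i * Num.max (K - y i) 0) ->
    (forall K, m * (a - K) <= \sum_i theta i * Num.max (y i - K) 0) ->
  exists eta : 'I_M -> R,
    [/\ forall i, 0 <= eta i <= theta i, contiguous theta eta,
        \sum_i eta i = m & \sum_i eta i * y i = m * a].
Proof.
move=> /andP[]; rewrite le_eqVlt => /predU1P[<- _ _ _|m_gt0 m_le put call].
  exists (fun=> 0); split=> [i|i1 i i2 _ _|| ].
  - by rewrite lexx theta_ge0.
  - by rewrite ltxx.
  - by rewrite big1.
  - by rewrite mul0r big1// => i _; rewrite mul0r.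
have M_gt0 : (0 < M)%N.
  by case: M theta m_le => // t; rewrite big_ord0 leNgt m_gt0.
have m_ge0 := ltW m_gt0.
set tot := \sum_i theta i in m_le.
(* The quantile band between the levels [s] and [s + m]. *)
pose band s i := lower (s + m) i - lower s i.
have band_mass s : 0 <= s <= tot - m -> \sum_i band s i = m.
  move=> ?; rewrite sumrB !lower_mass; last 2 first.
  - rewrite -/tot; lra.
  - rewrite -/tot; lra.
  by rewrite addrAC subrr add0r.
pose mean s := \sum_i band s i * y i.
have mean_bot : mean 0 <= m * a.
  have [b bE] := @lower_barrier m M_gt0 ltac:(by rewrite m_ge0).
  have /(le_trans (put b)) : \sum_i theta i * Num.max (b - y i) 0 <= m * b - mean 0.
    under eq_bigr do rewrite -bE mulrBr.
    rewrite sumrB -mulr_suml lower_mass ?m_ge0// lerB// /mean /band.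
    rewrite add0r; apply: ler_sum => i _.
    by rewrite /lower !(min_r (sumr_ge0 _ _)) ?subrr ?subr0.
  by rewrite mulrBr lerD2l lerN2.
have mean_top : m * a <= mean (tot - m).
  have top_range : 0 <= tot - m <= \sum_i theta i by rewrite -/tot; lra.
  have [b bE] := @lower_barrier (tot - m) M_gt0 top_range.
  have lower_tot i : lower tot i = theta i.
    have le_tot n : (n <= M)%N -> cum n <= tot by rewrite /tot -cumM; exact: le_cum.
    by rewrite /lower !min_l ?le_tot// 1?ltnW// cumS addrC addKr.
  have : \sum_i theta i * Num.max (y i - b) 0 = mean (tot - m) - m * b.
    rewrite -[X in _ - X * b](@band_mass (tot - m)) ?lexx ?andbT; last lra.
    rewrite mulr_suml -sumrB; apply: eq_bigr => i _.
    rewrite /band subrK lower_tot.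
    have -> : Num.max (y i - b) 0 = Num.max (b - y i) 0 + y i - b.
      by case: (leP (b - y i) 0); case: (leP (y i - b) 0); lra.
    rewrite -addrA mulrDr -bE; ring.
  move=> callE; move: (call b); rewrite callE; lra.
have range : 0 <= tot - m by lra.
have [||s] := @IVT R mean 0 (tot - m) (m * a) range.
- by apply: continuous_subspaceT; exact: band_continuous.
- by rewrite ge_min mean_bot le_max mean_top orbT.
rewrite in_itv/= => s_range meanE.
exists (band s); split=> [i|i1 i i2 i12 i23 p1 p2||]; [| |exact: band_mass|by []].
  rewrite subr_ge0 lower_homo ?lerDl//= /band.
  by move: (lower_bounds (s + m) i) (lower_bounds s i); lra.
(* Mass at an atom before [i] means that the band starts below atom [i]; mass at
   a later atom means that it ends above atom [i]. *)
have s_lt : s < cum i.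
  apply: lt_le_trans (le_cum i12); rewrite ltNge; apply/negP => sge.
  have := lower_bounds (s + m) i1; move: p1; rewrite /band /lower.
  by rewrite !(min_l sge, min_l (le_trans (le_cum (leqnSn i1)) sge)) cumS; lra.
have sm_gt : cum i.+1 < s + m.
  apply: le_lt_trans (le_cum i23) _; rewrite ltNge; apply/negP => sle.
  have := lower_bounds s i2; move: p2; rewrite /band /lower.
  by rewrite !(min_r sle, min_r (le_trans sle (le_cum (leqnSn i2)))); lra.
have iS := le_cum (leqnSn i).
rewrite /band /lower (min_l (ltW sm_gt)) (min_l (le_trans iS (ltW sm_gt))).
by rewrite (min_r (ltW s_lt)) (min_r (le_trans (ltW s_lt) iS)) cumS; lra.
Qed.

End Shadow.

(** * The convex order through potentials, and its inheritance by the residual *)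

Section Residual.
Variable R : realFieldType.

(** The convex order of two finitely supported measures of equal mass, tested on
affine functions and on the functions [fun z => `|z - K|]. *)
Definition potential_le (N M : nat) (omega x : 'I_N -> R) (theta y : 'I_M -> R) :=
  [/\ \sum_j omega j = \sum_i theta i,
      \sum_j omega j * x j = \sum_i theta i * y i &
      forall K, \sum_j omega j * `|x j - K| <= \sum_i theta i * `|y i - K|].

(** For [K] beyond all atoms, [`|z - K|] is affine on them; taking [K] far to the
left and far to the right gives the two inequalities between the means. *)
Lemma potential_le_mean (N M : nat)
    (omega x : 'I_N -> R) (theta y : 'I_M -> R) :
    \sum_j omega j = \sum_i theta i ->
    (forall K, \sum_j omega j * `|x j - K| <= \sum_i theta i * `|y i - K|) ->
  potential_le omega x theta y.
Proof.
move=> mass pot; split=> //.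
pose L := \sum_j `|x j| + \sum_i `|y i|.
have le_sum n (u : 'I_n -> R) i : `|u i| <= \sum_k `|u k|.
  by rewrite (bigD1 i)//= lerDl sumr_ge0.
have sum_abs_ge0 n (u : 'I_n -> R) : 0 <= \sum_k `|u k| by exact: sumr_ge0.
have xL j : `|x j| <= L by apply: le_trans (le_sum _ x j) _; rewrite lerDl.
have yL i : `|y i| <= L by apply: le_trans (le_sum _ y i) _; rewrite lerDr.
have low n (w u : 'I_n -> R) : (forall i, `|u i| <= L) ->
    \sum_i w i * `|u i - - L| = \sum_i w i * u i + (\sum_i w i) * L.
  move=> uL; rewrite mulr_suml -big_split; apply: eq_bigr => i _ /=.
  by rewrite opprK ger0_norm ?mulrDr// -lerBlDr sub0r; have /ler_normlP[] := uL i; lra.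
have high n (w u : 'I_n -> R) : (forall i, `|u i| <= L) ->
    \sum_i w i * `|u i - L| = (\sum_i w i) * L - \sum_i w i * u i.
  move=> uL; rewrite mulr_suml -sumrB; apply: eq_bigr => i _ /=.
  by rewrite distrC ger0_norm ?mulrBr// subr_ge0; have /ler_normlP[] := uL i; lra.
apply/eqP; rewrite eq_le; apply/andP; split.
  by have := pot (- L); rewrite !low// mass lerD2r.
by have := pot L; rewrite !high// mass lerD2l lerN2.
Qed.

Lemma sum_pos_part (n : nat) (w u : 'I_n -> R) :
  \sum_i w i * Num.max (u i) 0 = 2^-1 * (\sum_i w i * `|u i| + \sum_i w i * u i).
Proof.
rewrite -big_split mulr_sumr; apply: eq_bigr => i _ /=.
by rewrite maxr_absE subr0; ring.
Qed.

Lemma term_le_sum_pos_part (n : nat) (w u : 'I_n -> R) j : (forall i, 0 <= w i) ->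
  w j * u j <= \sum_i w i * Num.max (u i) 0.
Proof.
move=> w_ge0; rewrite (bigD1 j)//=; apply: ler_wpDr.
  by apply: sumr_ge0 => i _; rewrite mulr_ge0// le_max lexx orbT.
by rewrite ler_wpM2l// le_max lexx.
Qed.

(** A call or a put is half of [`|z - K|] plus an affine function. *)
Lemma call_put_le (N M : nat) (omega x : 'I_N -> R) (theta y : 'I_M -> R) K :
    potential_le omega x theta y ->
  (\sum_j omega j * Num.max (x j - K) 0 <= \sum_i theta i * Num.max (y i - K) 0) /\
  (\sum_j omega j * Num.max (K - x j) 0 <= \sum_i theta i * Num.max (K - y i) 0).
Proof.
move=> [mass mean pot]; rewrite !sum_pos_part.
have split_sum n (w u : 'I_n -> R) :
  (\sum_i w i * (u i - K) = \sum_i w i * u i - (\sum_i w i) * K) *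
  (\sum_i w i * (K - u i) = (\sum_i w i) * K - \sum_i w i * u i) *
  (\sum_i w i * `|K - u i| = \sum_i w i * `|u i - K|).
  do !split; last by apply: eq_bigr => i _; rewrite distrC.
    by rewrite mulr_suml -sumrB; apply: eq_bigr => i _; rewrite mulrBr.
  by rewrite mulr_suml -sumrB; apply: eq_bigr => i _; rewrite mulrBr.
rewrite !split_sum mass mean.
by split; rewrite ler_pM2l ?invr_gt0 ?ltr0n// lerD2r pot.
Qed.

(** Convexity of [fun K => `|z - K|], with the denominator [v - u] cleared. *)
Lemma abs_chord (u v K z : R) : u <= K -> K <= v ->
  (v - u) * `|z - K| <= (v - K) * `|z - u| + (K - u) * `|z - v|.
Proof.
move=> uK Kv; have uv := le_trans uK Kv.
rewrite -[v - u]ger0_norm ?subr_ge0// -[v - K in leRHS]ger0_norm ?subr_ge0//.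
rewrite -[K - u]ger0_norm ?subr_ge0// -!normrM.
apply: le_trans (ler_normD _ _); rewrite le_eqVlt; apply/orP; left; apply/eqP.
congr (`|_|); ring.
Qed.

(** The case of equality: [`|z - K|] is affine in [K] on intervals that do not
contain [z] in their interior. *)
Lemma abs_chord_outside (u v K z : R) : u <= K -> K <= v ->
  (z <= u) || (v <= z) ->
  (v - u) * `|z - K| = (v - K) * `|z - u| + (K - u) * `|z - v|.
Proof.
move=> uK Kv /orP[zu|vz].
  rewrite !ler0_norm ?subr_le0//; first ring.
  - exact: le_trans zu (le_trans uK Kv).
  - exact: le_trans zu uK.
rewrite !ger0_norm ?subr_ge0//; first ring.
- exact: le_trans (le_trans uK Kv) vz.
- exact: le_trans Kv vz.
Qed.

(** When [K] is not strictly inside the convex hull of [eta], the potential of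
[eta] at [K] is that of the Dirac mass it replaces, and both sides drop by the
same amount.  Inside the hull the residual [theta - eta] has no mass, so its
potential is affine there, whereas the potential of the remaining atoms is
convex: the inequality at the two ends of the hull is enough. *)
Lemma residual_potential_le (N M : nat) (omega x : 'I_N.+1 -> R)
    (theta y eta : 'I_M -> R) :
    (forall i k : 'I_M, (i < k)%N -> y i < y k) ->
    (forall j, 0 <= omega j) ->
    potential_le omega x theta y ->
    (forall i, 0 <= eta i <= theta i) -> contiguous theta eta ->
    \sum_i eta i = omega ord0 -> \sum_i eta i * y i = omega ord0 * x ord0 ->
  potential_le (fun j => omega (lift ord0 j)) (fun j => x (lift ord0 j))
    (fun i => theta i - eta i) y.
Proof.
move=> y_incr omega_ge0 [mass mean pot] bd cont eta_mass eta_mean.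
have y_le (i k : 'I_M) : (i <= k)%N -> y i <= y k.
  by rewrite leq_eqVlt => /predU1P[/val_inj->//|/y_incr/ltW].
split=> [||K].
- by rewrite sumrB eta_mass -mass big_ord_recl addrC addKr.
- under [RHS]eq_bigr do rewrite mulrBl.
  by rewrite sumrB eta_mean -mean big_ord_recl addrC addKr.
pose V K := \sum_j omega (lift ord0 j) * `|x (lift ord0 j) - K|.
pose U K := \sum_i (theta i - eta i) * `|y i - K|.
have outside c : (forall i, 0 < eta i -> y i <= c) \/ (forall i, 0 < eta i -> c <= y i) ->
    V c <= U c.
  move=> side.
  have etaU : \sum_i eta i * `|y i - c| = omega ord0 * `|x ord0 - c|.
    have centred : \sum_i eta i * (y i - c) = omega ord0 * (x ord0 - c).
      under eq_bigr do rewrite mulrBr.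
      by rewrite sumrB -mulr_suml eta_mass eta_mean mulrBr.
    rewrite -[omega ord0]ger0_norm// -normrM -centred.
    have zero_or i : eta i = 0 \/ 0 < eta i.
      have /andP[] := bd i; rewrite le_eqVlt => /predU1P[<-|]; first by left.
      by right.
    case: side => side.
      rewrite ler0_norm -?sumrN; last first.
        apply: sumr_le0 => i _; have [->|p] := zero_or i; first by rewrite mul0r.
        by rewrite pmulr_rle0// subr_le0 side.
      apply: eq_bigr => i _; have [->|p] := zero_or i.
        by rewrite !mul0r oppr0.
      by rewrite ler0_norm ?mulrN// subr_le0 side.
    rewrite ger0_norm; last first.
      apply: sumr_ge0 => i _; have [->|p] := zero_or i; first by rewrite mul0r.
      by rewrite pmulr_rge0// subr_ge0 side.
    apply: eq_bigr => i _; have [->|p] := zero_or i; first by rewrite !mul0r.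
    by rewrite ger0_norm// subr_ge0 side.
  have := pot c; rewrite big_ord_recl -etaU -/(V c).
  rewrite -lerBrDl -sumrB => /le_trans; apply; rewrite le_eqVlt.
  by apply/orP; left; apply/eqP/eq_bigr => i _; rewrite mulrBl.
rewrite -/(V K) -/(U K).
have [/forallP above|] := boolP [forall i, (0 < eta i) ==> (K <= y i)].
  by apply: outside; right => i; exact/implyP.
rewrite negb_forall => /existsP[i0]; rewrite negb_imply -ltNge => /andP[pi0 yi0].
have [/forallP below|] := boolP [forall i, (0 < eta i) ==> (y i <= K)].
  by apply: outside; left => i; exact/implyP.
rewrite negb_forall => /existsP[i1]; rewrite negb_imply -ltNge => /andP[pi1 yi1].
case: (@arg_minnP _ i0 (fun i => 0 < eta i) (fun i => i : nat) pi0) => u pu u_min.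
case: (@arg_maxnP _ i1 (fun i => 0 < eta i) (fun i => i : nat) pi1) => v pv v_max.
have uK : y u < K by apply: le_lt_trans yi0; exact/y_le/u_min.
have Kv : K < y v by apply: lt_le_trans yi1 _; exact/y_le/v_max.
have Vu : V (y u) <= U (y u) by apply: outside; right => i /u_min/y_le.
have Vv : V (y v) <= U (y v) by apply: outside; left => i /v_max/y_le.
have V_chord : (y v - y u) * V K <= (y v - K) * V (y u) + (K - y u) * V (y v).
  rewrite !mulr_sumr -big_split; apply: ler_sum => j _ /=.
  rewrite !(mulrCA _ (omega _)) -mulrDr; apply: ler_wpM2l => //.
  by apply: abs_chord; exact: ltW.
have U_chord : (y v - y u) * U K = (y v - K) * U (y u) + (K - y u) * U (y v).
  rewrite !mulr_sumr -big_split; apply: eq_bigr => i _ /=.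
  rewrite !(mulrCA _ (theta i - _)) -mulrDr.
  have [iu|ui] := leqP i u.
    by rewrite (abs_chord_outside (ltW uK) (ltW Kv))// y_le.
  have [vi|iv] := leqP v i.
    by rewrite (abs_chord_outside (ltW uK) (ltW Kv))// (y_le _ _ vi) orbT.
  by rewrite (cont u i v)// subrr !mul0r.
rewrite -(@ler_pM2l _ (y v - y u)) ?subr_gt0 ?(lt_trans uK)// U_chord.
apply: le_trans V_chord _; apply: lerD; apply: ler_wpM2l => //.
  by rewrite subr_ge0 ltW.
by rewrite subr_ge0 ltW.
Qed.

End Residual.

(** * Existence of the left-monotone matrix *)

Lemma left_curtain_exists (R : realType) (N M : nat)
    (omega x : 'I_N -> R) (theta y : 'I_M -> R) :
    (forall i k : 'I_M, (i < k)%N -> y i < y k) ->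
    (forall j, 0 <= omega j) -> (forall i, 0 <= theta i) ->
    potential_le omega x theta y ->
  exists q, martingale_coupling omega x theta y q /\ left_curtain q.
Proof.
move=> y_incr.
elim: N omega x theta => [|N IHN] omega x theta omega_ge0 theta_ge0 cx.
  exists (fun _ _ => 0); split; last by case.
  split=> [[]//|[]//|i|[]//].
  have [mass _ _] := cx; rewrite big_ord0 in mass.
  by rewrite big_ord0 (psumr_eq0P _ (esym mass)).
have [mass _ _] := cx.
have [|||eta [bd cont eta_mass eta_mean]] :=
    @exists_shadow _ _ _ _ theta_ge0 y_incr (omega ord0) (x ord0).
- by rewrite omega_ge0 -mass big_ord_recl lerDl sumr_ge0.
- move=> K; apply: le_trans (call_put_le K cx).2.
  exact: (@term_le_sum_pos_part _ _ omega (fun j => K - x j)).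
- move=> K; apply: le_trans (call_put_le K cx).1.
  exact: (@term_le_sum_pos_part _ _ omega (fun j => x j - K)).
have [||q [cpl lc]] := IHN _ _ (fun i => theta i - eta i) _ _
  (residual_potential_le y_incr omega_ge0 cx bd cont eta_mass eta_mean).
- by move=> j; exact: omega_ge0.
- by move=> i; rewrite subr_ge0; have /andP[] := bd i.
have [q_ge0 row col mart] := cpl.
pose q1 j i := if unlift ord0 j is Some j' then q j' i else eta i.
have q10 i : q1 ord0 i = eta i by rewrite /q1 unlift_none.
have q1S j i : q1 (lift ord0 j) i = q j i by rewrite /q1 liftK.
have eta_ge0 i : 0 <= eta i by have /andP[] := bd i.
exists q1; split; first split.
- by move=> j i; rewrite /q1; case: unliftP.
- move=> j; case: (unliftP ord0 j) => [j'|] ->.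
    by rewrite -row; apply: eq_bigr => i _.
  by rewrite -eta_mass; apply: eq_bigr => i _.
- move=> i; rewrite big_ord_recl q10; under eq_bigr do rewrite q1S.
  by rewrite col addrC subrK.
- move=> j; case: (unliftP ord0 j) => [j'|] ->.
    by rewrite -[RHS](mart j'); apply: eq_bigr => i _; rewrite q1S.
  under eq_bigr do rewrite q10 mulrBr.
  by rewrite sumrB -mulr_suml eta_mass eta_mean subrr.
- move=> j j' i1 i i2; case: (unliftP ord0 j') => [k'|] ->; last by rewrite ltn0.
  case: (unliftP ord0 j) => [k|] -> jj' i12 i23.
    by rewrite !q1S => p1 p2; apply: (lc k k' i1 i i2) => //; rewrite -ltnS.
  rewrite !q10 q1S => p1 p2.
  apply: (psumr_eq0P (P := xpredT) (F := fun j => q j i)) => //.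
  by rewrite col (cont i1 i i2)// subrr.
Qed.

(** * Finitely supported measures *)

Section Atomic.
Local Open Scope ereal_scope.
Context d (T : measurableType d) (R : realType) (I : finType).
Variables (c : I -> R) (a : I -> T).
Hypothesis c_ge0 : forall i, (0 <= c i)%R.

(** The integral formula comes along the same induction as the construction; by
[eq_measure_integral] it then holds for every measure with these values. *)
Lemma exists_atomic_measure : exists m : {measure set T -> \bar R},
  (forall A, m A = \sum_i (c i)%:E * \d_(a i) A) /\
  (forall f : T -> \bar R, measurable_fun [set: T] f -> (forall z, 0 <= f z) ->
    \int[m]_z f z = \sum_i (c i)%:E * f (a i)).
Proof.
elim: (index_enum I) => [|i r [m [mE intE]]].
  exists mzero; split=> [A|f mf f0]; first by rewrite big_nil.
  by rewrite big_nil integral_measure_zero.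
pose ci : {nonneg R} := NngNum (c_ge0 i).
exists (measure_add (mscale ci (\d_(a i))) m); split=> [A|f mf f0].
  by rewrite [LHS]measure_addE mE big_cons.
rewrite ge0_integral_measure_add//= ge0_integral_mscale//= integral_dirac//=.
by rewrite diracT mul1e intE// big_cons.
Qed.

Lemma integral_atomic (mu : {measure set T -> \bar R}) (f : T -> R) :
    (forall A, mu A = \sum_i (c i)%:E * \d_(a i) A) ->
    measurable_fun [set: T] f -> (forall z, 0 <= f z)%R ->
  \int[mu]_z (f z)%:E = (\sum_i c i * f (a i))%R%:E.
Proof.
move=> muE mf f0; have [m [mE intE]] := exists_atomic_measure.
rewrite (eq_measure_integral m) => [|A _ _]; last by rewrite mE; exact: muE.
rewrite intE//; first by rewrite -sumEFin.
exact/measurable_EFinP.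
Qed.

End Atomic.

(** All components of the structure other than the function are propositions. *)
Lemma probability_ext d (T : measurableType d) (R : realType)
    (P Q : probability T R) : (forall A, P A = Q A) -> P = Q.
Proof.
move=> PQ; have {PQ} : (P : set T -> \bar R) = Q by exact/funext.
case: P => P cP; case: Q => Q cQ /= PQ; subst Q.
case: cP => -[p1 p2] [p3] [p4] [p5] [p6] [p7] [p8].
case: cQ => -[q1 q2] [q3] [q4] [q5] [q6] [q7] [q8].
have E1 := Prop_irrelevance q1 p1; have E2 := Prop_irrelevance q2 p2; subst q1 q2.
have E3 := Prop_irrelevance q3 p3; have E4 := Prop_irrelevance q4 p4; subst q3 q4.
have E5 := Prop_irrelevance q5 p5; have E6 := Prop_irrelevance q6 p6; subst q5 q6.
have E7 := Prop_irrelevance q7 p7; have E8 := Prop_irrelevance q8 p8; subst q7 q8.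
by [].
Qed.

(** A measure of mass 1 is its own normalization; the Dirac measure is the value
[mnormalize] would take on a measure that cannot be normalized. *)
Lemma measure1_probability d (T : measurableType d) (R : realType)
    (m : {measure set T -> \bar R}) :
  m [set: T] = 1%E -> exists P : probability T R, forall A, P A = m A.
Proof.
move=> m1; have [z _] : [set: T] !=set0.
  by apply/set0P/eqP => T0; move: m1; rewrite T0 measure0 => -[] /esym/eqP; rewrite oner_eq0.
exists (mnormalize m (\d_z)) => A.
by rewrite /= /mnormalize m1 onee_eq0/= invr1 mule1.
Qed.

Lemma atomic_full d (T : measurableType d) (R : realType) (I : finType)
    (c : I -> R) (a : I -> T) (A : set T) :
    (forall i, 0 <= c i) -> \sum_i c i = 1 ->
  (\sum_i (c i)%:E * \d_(a i) A)%E = 1%E <-> (forall i, 0 < c i -> A (a i)).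
Proof.
move=> c_ge0 c1.
have -> : (\sum_i (c i)%:E * \d_(a i) A)%E = (\sum_i c i * (a i \in A)%:R)%:E.
  by rewrite -sumEFin; apply: eq_bigr => i _; rewrite diracE.
split=> [[full] i ci|full]; last first.
  congr (_%:E); rewrite -[RHS]c1; apply: eq_bigr => i _.
  have := c_ge0 i; rewrite le_eqVlt => /predU1P[<-|/full Ai]; first by rewrite mul0r.
  by rewrite mem_set// mulr1.
have rest0 : \sum_i c i * (1 - (a i \in A)%:R) = 0.
  under eq_bigr do rewrite mulrBr mulr1.
  by rewrite sumrB c1 full subrr.
apply: contrapT => nAi.
have : c i * (1 - (a i \in A)%:R) = 0.
  apply: (psumr_eq0P _ rest0) => // k _; rewrite mulr_ge0// subr_ge0.
  by case: (_ \in _).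
by rewrite memNset// subr0 mulr1 => ci0; rewrite ci0 ltxx in ci.
Qed.

Lemma supp_atomic (R : realType) (n : nat) (w u : 'I_n -> R)
    (rho : probability (line R) R) i :
    (forall k, 0 <= w k) -> (forall A, rho A = atomic w u A) -> 0 < w i ->
  supp rho (u i).
Proof.
move=> w_ge0 rhoE wi; rewrite /supp/= rhoE /atomic (bigD1 i)//=.
apply: (@lt_le_trans _ _ (w i)%:E); first by rewrite lte_fin.
rewrite diracE mem_set// mule1 leeDl// sume_ge0// => k _.
by rewrite mule_ge0// lee_fin.
Qed.

(** * From measures to matrices *)

Lemma convex_order_potential (R : realType) (N M : nat)
    (omega x : 'I_N -> R) (theta y : 'I_M -> R) (mu nu : probability (line R) R) :
    (forall j, 0 <= omega j) -> (forall i, 0 <= theta i) ->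
    \sum_j omega j = 1 -> \sum_i theta i = 1 ->
    (forall A, mu A = atomic omega x A) -> (forall A, nu A = atomic theta y A) ->
    convex_order mu nu ->
  potential_le omega x theta y.
Proof.
move=> omega_ge0 theta_ge0 omega1 theta1 muE nuE mu_nu.
apply: potential_le_mean; first by rewrite omega1.
move=> K; pose f (z : R) : R := `|z - K|.
have mf : measurable_fun [set: line R] f.
  by apply: measurableT_comp => //; exact: measurable_funB.
have f_ge0 z : 0 <= f z by exact: normr_ge0.
have integrable_atomic n (w u : 'I_n -> R) (rho : probability (line R) R) :
    (forall i, 0 <= w i) -> (forall A, rho A = atomic w u A) ->
    rho.-integrable [set: line R] (EFin \o f).
  move=> w_ge0 rhoE; apply/integrableP; split; first exact/measurable_EFinP.
  under eq_integral do rewrite /= ger0_norm//.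
  by rewrite (integral_atomic w_ge0 rhoE)// ltry.
have f_convex : convex_function [set: R^o] f.
  move=> t u v _ _.
  have chord (p : R) : 0 <= p <= 1 ->
      f (p * u + (1 - p) * v) <= p * f u + (1 - p) * f v.
    move=> /andP[p_ge0 p_le1]; rewrite /f.
    rewrite -[X in _ <= X * _ + _]ger0_norm// -[X in _ <= _ + X * _]ger0_norm ?subr_ge0//.
    rewrite -!normrM; apply: le_trans (ler_normD _ _).
    by rewrite le_eqVlt; apply/orP; left; apply/eqP; congr (`|_|); ring.
  by apply: (chord t%:inum); rewrite ge0 le1.
have := mu_nu f f_convex (integrable_atomic _ _ _ _ omega_ge0 muE)
  (integrable_atomic _ _ _ _ theta_ge0 nuE).
by rewrite (integral_atomic omega_ge0 muE)// (integral_atomic theta_ge0 nuE)// lee_fin.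
Qed.

(** A set of full measure contains every charged point, so its monotonicity
passes to the support of [q]; conversely that support has full measure and lies
in the product of the supports of the marginals. *)
Lemma left_monotoneP (R : realType) (N M : nat)
    (omega x : 'I_N -> R) (theta y : 'I_M -> R) (mu nu : probability (line R) R)
    (q : 'I_N -> 'I_M -> R) (Q : probability (plane R) R) :
    (forall j k : 'I_N, (j < k)%N -> x j < x k) ->
    (forall i k : 'I_M, (i < k)%N -> y i < y k) ->
    \sum_j omega j = 1 ->
    (forall A, mu A = atomic omega x A) -> (forall A, nu A = atomic theta y A) ->
    martingale_coupling omega x theta y q ->
    (forall A : set (plane R), Q A = \sum_(j < N) \sum_(i < M)
      (q j i)%:E * \d_((x j, y i) : plane R) A)%E ->
  left_monotone mu nu Q <-> left_curtain q.
Proof.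
move=> x_incr y_incr omega1 muE nuE [q_ge0 row col _] QE.
have omega_ge0 j : 0 <= omega j by rewrite -row sumr_ge0.
have theta_ge0 i : 0 <= theta i by rewrite -col sumr_ge0.
have index_lt n (u : 'I_n -> R) (incr : forall i k : 'I_n, (i < k)%N -> u i < u k)
    (i k : 'I_n) : u i < u k -> (i < k)%N.
  apply: contraTltn; rewrite -leNgt leq_eqVlt => /predU1P[/val_inj->//|/incr/ltW//].
have full A : Q A = 1%E <-> forall j i, 0 < q j i -> A (x j, y i).
  rewrite QE pair_bigA/=.
  have [||full1 full2] := @atomic_full _ (plane R) R _ (fun p : 'I_N * 'I_M => q p.1 p.2)
    (fun p => (x p.1, y p.2)) A.
  - by case.
  - by rewrite -(pair_bigA _ q)/= -omega1; apply: eq_bigr => j _; rewrite row.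
  split=> [/full1 QA j i|QA]; first exact: (QA (j, i)).
  by apply: full2 => -[j i]; exact: QA.
split=> [[G [_ [/full QG mono]]] j j' i1 i i2 jj' i12 i23 p1 p2|curtain].
  apply/eqP; rewrite eq_le q_ge0 andbT leNgt; apply/negP => p.
  by apply: (mono _ _ _ _ _ (QG _ _ p1) (QG _ _ p2) (QG _ _ p) (x_incr _ _ jj'));
    split; exact: y_incr.
exists [set z | exists j i, z = (x j, y i) /\ 0 < q j i]; split; [|split].
- move=> _ [j [i [-> p]]]; split=> /=.
    apply: (supp_atomic omega_ge0 muE); apply: lt_le_trans p _.
    by rewrite -row (bigD1 i)//= lerDl sumr_ge0.
  apply: (supp_atomic theta_ge0 nuE); apply: lt_le_trans p _.
  by rewrite -col (bigD1 j)//= lerDl sumr_ge0.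
- by apply/full => j i p; exists j, i.
- move=> a b b' a' c [j [i1 [[-> ->] p1]]] [k [i2 [[/esym xk ->] p2]]].
  move=> [j' [i [[-> ->] p]]] /(index_lt _ _ x_incr) jj'.
  move=> [/(index_lt _ _ y_incr) i12 /(index_lt _ _ y_incr) i23].
  have {xk} kj : k = j.
    by have [/x_incr|/x_incr|/val_inj//] := ltngtP k j; rewrite xk ltxx.
  by rewrite kj in p2; rewrite (curtain j j' i1 i i2)// ltxx in p.
Qed.

Theorem theorem5p4 (R : realType) (N M : nat)
    (omega x : 'I_N -> R) (theta y : 'I_M -> R)
    (mu nu : probability (line R) R)
    (omega_ge0 : forall j, 0 <= omega j) (omega_sum : \sum_j omega j = 1)
    (theta_ge0 : forall i, 0 <= theta i) (theta_sum : \sum_i theta i = 1)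
    (mu_def : forall A, mu A = atomic omega x A)
    (nu_def : forall A, nu A = atomic theta y A)
    (x_incr : forall j k : 'I_N, (j < k)%N -> x j < x k)
    (y_incr : forall i k : 'I_M, (i < k)%N -> y i < y k)
    (mu_le_nu : convex_order mu nu)
    (mu_neq_nu : mu <> nu)
    (two_atoms : exists a b : R, supp mu a /\ supp mu b /\ a <> b) :
  exists! Q : probability (plane R) R,
    martingale_plans omega x theta y Q /\ left_monotone mu nu Q.
Proof.
have monoP := left_monotoneP x_incr y_incr omega_sum mu_def nu_def.
have cx := convex_order_potential omega_ge0 theta_ge0 omega_sum theta_sum
  mu_def nu_def mu_le_nu.
have [q [cpl lc]] := left_curtain_exists y_incr omega_ge0 theta_ge0 cx.
have [q_ge0 row col mart] := cpl.
have [m [mE _]] := @exists_atomic_measure _ (plane R) R _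
  (fun p : 'I_N * 'I_M => q p.1 p.2) (fun p => (x p.1, y p.2)) (fun p => q_ge0 _ _).
have m1 : m [set: plane R] = 1%E.
  rewrite mE; apply/atomic_full => //.
  by rewrite -(pair_bigA _ q)/= -omega_sum; apply: eq_bigr => j _; rewrite row.
have [Q Qm] := measure1_probability m1.
have QE (A : set (plane R)) : Q A = (\sum_(j < N) \sum_(i < M)
    (q j i)%:E * \d_((x j, y i) : plane R) A)%E.
  by rewrite Qm mE pair_bigA.
exists Q; split.
  split; last exact/(monoP q).
  by exists q.
move=> Q' [[q' [q'_ge0 [row' [col' [mart' QE']]]]]].
have cpl' : martingale_coupling omega x theta y q' by split.
move=> /(monoP q' Q' cpl' QE') lc'.
apply: probability_ext => A; rewrite QE QE'.
do 2!apply: eq_bigr => ? _; congr (_%:E * _)%E.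
exact: left_curtain_unique y_incr cpl lc cpl' lc' _ _.
Qed.
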